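(* Let $\lambda\in\mathbb{C}$, $\mu\ge0$, and let $f\in\mathcal{R}$ with $f(z)=z+\sum_{n=2}^\infty a_nz^n$. Define $F_{\lambda,\mu}(f)=|a_3-\lambda a_2^2|-\mu|a_2|$. Then \[ F_{\lambda,\mu}(f)\le\begin{cases}\dfrac13\big(|2-3\lambda|-3\mu\big), & |2-3\lambda|\ge2+3\mu,\\[2mm] \dfrac23, & |2-3\lambda|<2+3\mu,\end{cases} \] and \[ F_{\lambda,\mu}(f)\ge\begin{cases}-\dfrac13\big(3\mu-|2-3\lambda|\big), & |2-3\lambda|\le\dfrac{3\mu-4}{2},\\[2mm] -\mu\sqrt{\dfrac{2}{|2-3\lambda|+2}}, & |2-3\lambda|\ge\dfrac{9\mu^2-16}{8},\\[2mm] -\dfrac1{12}\left(8+\dfrac{9\mu^2}{|2-3\lambda|+2}\right), & \dfrac{3\mu-4}{2}<|2-3\lambda|<\dfrac{9\mu^2-16}{8}.\end{cases} \] All inequalities are sharp (each bound is attained by some $f\in\mathcal{R}$).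
   Context: $\mathbb{D}$ is the open unit disk; $\mathcal{A}$ is the class of holomorphic $f$ on $\mathbb{D}$ with $f(0)=0$, $f'(0)=1$; $\mathcal{R}=\{f\in\mathcal{A}:\operatorname{Re} f'(z)>0\ \forall z\in\mathbb{D}\}$ (functions of bounded turning). *)

(* Defs.v *)
(* with Coquelicot complex numbers C.
   [is_derive] below is instantiated at K = C_AbsRing, i.e. it is the
   complex (holomorphic) derivative. *)
From Stdlib Require Import Reals.
From Coquelicot Require Import Coquelicot.
Open Scope R_scope.

Definition in_disk (z : C) : Prop := Cmod z < 1.

Definition holo_on_disk (f : C -> C) : Prop :=
  forall z : C, in_disk z -> exists l : C, is_derive f z l.

Definition class_A (f : C -> C) : Prop :=
  holo_on_disk f /\ f (RtoC 0) = RtoC 0 /\ is_derive f (RtoC 0) (RtoC 1).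

Definition class_R (f : C -> C) : Prop :=
  class_A f /\
  forall z : C, in_disk z -> forall l : C, is_derive f z l -> 0 < Re l.

Definition taylor_coeffs (f : C -> C) (a : nat -> C) : Prop :=
  forall z : C, in_disk z -> is_series (fun n => (a n * Cpow z n)%C) (f z).

Definition Ffun (lam : C) (mu : R) (a : nat -> C) : R :=
  Cmod (a 3%nat - lam * a 2%nat * a 2%nat)%C - mu * Cmod (a 2%nat).

(* Main.v *)
(* Write p = f' = 1 + p_1 z + p_2 z^2 + ..., so p_1 = 2 a_2 and p_2 = 3 a_3. Averaging
   Re p(r w) (Re w + b)^2 >= 0 over the N-th roots of unity w, letting N tend to infinity,
   choosing b = - r Re p_1 / 2 and letting r tend to 1 gives Re p_2 >= (Re p_1)^2 - 2; a
   rotation of the disk turns this into |3 a_3 - 2 a_2^2| <= 2 - 2 |a_2|^2. Since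
   3 (a_3 - lam a_2^2) = (3 a_3 - 2 a_2^2) + (2 - 3 lam) a_2^2, both estimates become the
   optimization of a quadratic in t = |a_2| in [0, 1]. Equality is attained because, for
   every |c| <= 1, a two-point Herglotz measure produces f with a_2 = c and
   3 a_3 - 2 a_2^2 = - (2 - 2 |c|^2), and the argument of c is free. *)
Require Import Defs.
From Stdlib Require Import Reals Lra Lia ZArith.
From Coquelicot Require Import Coquelicot.
Open Scope R_scope.

(** * Complex power series *)

Lemma is_C_series_alt (u : nat -> C) (l : C) :
  is_series (K := C_AbsRing) (V := C_NormedModule) u l <->
  forall eps : posreal, exists N, forall n, (N <= n)%nat ->
    Cmod (sum_n (G := C_NormedModule) u n - l)%C < eps.
Proof.
  unfold is_series. split.
  - intros H. exact (proj1 (filterlim_locally_ball_norm _ _) H).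
  - intros H. exact (proj2 (filterlim_locally_ball_norm (K := C_AbsRing) (U := C_NormedModule) _ l) H).
Qed.

Lemma is_C_series_Cmod_le (u : nat -> C) (l : C) (B : R) :
  is_series (K := C_AbsRing) (V := C_NormedModule) u l ->
  (forall n, Cmod (sum_n (G := C_NormedModule) u n) <= B) -> Cmod l <= B.
Proof.
  intros Hu HB. apply le_epsilon. intros e He.
  destruct (proj1 (is_C_series_alt u l) Hu (mkposreal e He)) as [N HN].
  specialize (HN N (Nat.le_refl N)). specialize (HB N). simpl in HN.
  set (s := sum_n _ N) in *.
  replace l with (s + - (s - l))%C by ring.
  eapply Rle_trans; [apply Cmod_triangle|]. rewrite Cmod_opp. lra.
Qed.

Lemma sum_n_Cmod_le (u : nat -> C) (v : nat -> R) (B : R) :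
  (forall n, Cmod (u n) <= v n) -> is_series v B ->
  forall n, Cmod (sum_n (G := C_NormedModule) u n) <= B.
Proof.
  intros Huv Hv n.
  assert (Hp : forall k, 0 <= v k).
  { intros k. eapply Rle_trans; [apply Cmod_ge_0 | apply Huv]. }
  apply Rle_trans with (sum_n v n).
  - induction n as [|n IH].
    + rewrite !sum_O. apply Huv.
    + rewrite !sum_Sn. eapply Rle_trans; [apply Cmod_triangle|].
      apply Rplus_le_compat; [exact IH | apply Huv].
  - apply (is_lim_seq_incr_compare (sum_n v) B Hv).
    intros k. rewrite sum_Sn. unfold plus; simpl. specialize (Hp (S k)). lra.
Qed.

Lemma is_C_derive_quadratic (f : C -> C) (z d : C) (delta K : R) :
  0 < delta ->
  (forall w, Cmod (w - z)%C < delta ->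
     Cmod (f w - f z - (w - z) * d)%C <= K * Cmod (w - z)%C ^ 2) ->
  is_derive (K := C_AbsRing) (V := C_NormedModule) f z d.
Proof.
  intros Hd H. split; [apply is_linear_scal_l|].
  intros x Hx.
  (* The estimate is asked at every limit point of [locally z]; the only one is [z]. *)
  assert (Ex : z = x) by (apply (is_filter_lim_locally_unique (K:=C_AbsRing) (V := AbsRing_NormedModule C_AbsRing)); exact Hx).
  subst x. intros eps.
  (* [Rabs K + 1] replaces [K] so that the divisor is positive whatever the sign of [K]. *)
  assert (HK : 0 < Rabs K + 1) by (generalize (Rabs_pos K); lra).
  assert (Hm : 0 < Rmin delta (eps / (Rabs K + 1))).
  { apply Rmin_pos; [exact Hd|]. apply Rdiv_lt_0_compat; [apply cond_pos | exact HK]. }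
  exists (mkposreal _ Hm). intros w Hw.
  change (Cmod (w - z)%C < Rmin delta (eps / (Rabs K + 1))) in Hw.
  change (Cmod (f w - f z - (w - z) * d)%C <= eps * Cmod (w - z)%C).
  assert (H1 := Rlt_le_trans _ _ _ Hw (Rmin_l _ _)).
  assert (H2 := Rlt_le_trans _ _ _ Hw (Rmin_r _ _)).
  eapply Rle_trans; [apply H, H1|].
  assert (H0 := Cmod_ge_0 (w - z)%C).
  set (h := Cmod (w - z)%C) in *.
  replace (K * h ^ 2) with (K * h * h) by ring.
  apply Rmult_le_compat_r; [exact H0|].
  apply Rle_trans with ((Rabs K + 1) * h).
  - apply Rmult_le_compat_r; [exact H0|]. generalize (Rle_abs K); lra.
  - apply (Rmult_lt_compat_l _ _ _ HK) in H2.
    replace ((Rabs K + 1) * (eps / (Rabs K + 1))) with (pos eps) in H2 by (field; lra).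
    lra.
Qed.

(** [CV_radius] is the least upper bound of the radii at which the terms stay bounded. Were it some
    c < 1, the radius (1 + c) / 2 would exceed it. *)
Lemma CV_radius_ge_1 (a : nat -> R) :
  (forall r, 0 <= r < 1 -> exists M, forall n, Rabs (a n * r ^ n) <= M) ->
  Rbar_le 1 (CV_radius a).
Proof.
  intros H. destruct (CV_radius_bounded a) as [Hub _].
  destruct (CV_radius a) as [c| |] eqn:E; simpl in *; trivial.
  - apply Rnot_lt_le. intros Hc.
    assert (H0 : 0 <= c).
    { apply (Hub 0). destruct (H 0) as [M HM]; [lra|]. now exists M. }
    assert (H1 := Hub ((1 + c) / 2) (H ((1 + c) / 2) ltac:(lra))). simpl in H1. lra.
  - apply (Hub 0). destruct (H 0) as [M HM]; [lra|]. now exists M.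
Qed.

(** Convergence at the real point [r] bounds the partial sums by some [M]; each term is a difference
    of consecutive partial sums, hence at most [2 * M]. *)
Lemma taylor_CV_radius (f : C -> C) (a : nat -> C) :
  taylor_coeffs f a -> Rbar_le 1 (CV_radius (fun n => Cmod (a n))).
Proof.
  intros Hf. apply CV_radius_ge_1. intros r Hr.
  assert (Hd : in_disk (RtoC r)).
  { unfold in_disk. rewrite Cmod_R, Rabs_pos_eq; lra. }
  specialize (Hf _ Hd).
  destruct (filterlim_bounded _ (ex_intro _ _ Hf)) as [M HM].
  exists (2 * M). intros n.
  replace (Cmod (a n) * r ^ n) with (Cmod (a n * RtoC r ^ n)%C)
    by (rewrite Cmod_mult, Cmod_pow, Cmod_R, (Rabs_pos_eq r) by lra; reflexivity).
  rewrite Rabs_pos_eq by apply Cmod_ge_0.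
  change (forall n, Cmod (sum_n (G := C_NormedModule) (fun n : nat => (a n * r ^ n)%C) n)
            <= M) in HM.
  destruct n as [|n].
  - specialize (HM 0%nat). rewrite sum_O in HM. generalize (Cmod_ge_0 (a O * r ^ 0)%C). lra.
  - assert (H1 := HM n). assert (H2 := HM (S n)). rewrite sum_Sn in H2.
    set (s := sum_n _ n) in *. unfold plus in H2; simpl in H2.
    replace (a (S n) * r ^ S n)%C with ((s + a (S n) * r ^ S n) + - s)%C by ring.
    eapply Rle_trans; [apply Cmod_triangle|]. rewrite Cmod_opp. simpl. lra.
Qed.

Lemma ex_series_disk (a : nat -> R) (r : R) :
  (forall n, 0 <= a n) -> Rbar_le 1 (CV_radius a) -> 0 <= r < 1 ->
  ex_series (fun n => a n * r ^ n).
Proof.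
  intros Ha Hc Hr. apply ex_series_ext with (fun n => Rabs (a n * r ^ n)).
  - intros n. apply Rabs_pos_eq, Rmult_le_pos; [apply Ha | apply pow_le; lra].
  - apply CV_disk_inside. rewrite Rabs_pos_eq by lra.
    apply Rbar_lt_le_trans with 1; [simpl; lra | exact Hc].
Qed.

Lemma ex_C_series_disk (a : nat -> C) (z : C) :
  Rbar_le 1 (CV_radius (fun n => Cmod (a n))) -> in_disk z ->
  exists l, is_series (K := C_AbsRing) (V := C_NormedModule)
              (fun n => (a n * z ^ n)%C) l.
Proof.
  intros Ha Hz.
  apply (ex_series_le (K := C_AbsRing) (V := C_CompleteNormedModule)
           (fun n => (a n * z ^ n)%C) (fun n => Cmod (a n) * Cmod z ^ n)).
  - intros n. change (Cmod (a n * z ^ n)%C <= Cmod (a n) * Cmod z ^ n).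
    rewrite Cmod_mult, Cmod_pow. apply Rle_refl.
  - apply (ex_series_disk (fun n => Cmod (a n))); trivial.
    + intros n. apply Cmod_ge_0.
    + split; [apply Cmod_ge_0 | exact Hz].
Qed.

Definition C_PS_derive (a : nat -> C) (n : nat) : C := (INR (S n) * a (S n))%C.

(** The moduli of the derived coefficients are the real [PS_derive] of the moduli. *)
Lemma CV_radius_C_PS_derive (a : nat -> C) :
  CV_radius (fun n => Cmod (C_PS_derive a n)) = CV_radius (fun n => Cmod (a n)).
Proof.
  rewrite <- (CV_radius_derive (fun n => Cmod (a n))). apply CV_radius_ext.
  intros n. unfold C_PS_derive, PS_derive.
  rewrite Cmod_mult, Cmod_R, Rabs_pos_eq; [reflexivity | apply pos_INR].
Qed.

(* [w^n - z^n - n z^(n-1) (w - z)] is [(w - z)^2] times a sum of [n (n - 1) / 2]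
   monomials of degree [n - 2]; here the index [n] is shifted by 2. *)
Lemma pow_taylor2_bound (w z : C) (s : R) (n : nat) :
  Cmod w <= s -> Cmod z <= s ->
  Cmod (w ^ S (S n) - z ^ S (S n) - INR (S (S n)) * z ^ S n * (w - z))%C
    <= INR (S n) * INR (S (S n)) * s ^ n * Cmod (w - z)%C ^ 2.
Proof.
  intros Hw Hz. assert (Hh := Cmod_ge_0 (w - z)%C).
  assert (H0 := Cmod_ge_0 z).
  induction n as [|n IH].
  - replace (w ^ 2 - z ^ 2 - INR 2 * z ^ 1 * (w - z))%C with ((w - z) ^ 2)%C.
    + rewrite Cmod_pow. simpl INR. generalize (pow2_ge_0 (Cmod (w - z)%C)). lra.
    + simpl INR. rewrite RtoC_plus. ring.
  (* Multiplying the previous remainder by [w] gives the next one up to a multiple of (w - z)^2. *)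
  - replace (w ^ S (S (S n)) - z ^ S (S (S n)) - INR (S (S (S n))) * z ^ S (S n) * (w - z))%C
      with (w * (w ^ S (S n) - z ^ S (S n) - INR (S (S n)) * z ^ S n * (w - z))
            + INR (S (S n)) * z ^ S n * (w - z) ^ 2)%C.
    2: { rewrite (S_INR (S (S n))), RtoC_plus. rewrite !Cpow_S. ring. }
    eapply Rle_trans; [apply Cmod_triangle|].
    rewrite !Cmod_mult, !Cmod_pow, Cmod_R, Rabs_pos_eq by apply pos_INR.
    assert (Hs : Cmod z ^ S n <= s ^ S n) by (apply pow_incr; lra).
    assert (Hn := pos_INR (S (S n))). assert (H2 := pow2_ge_0 (Cmod (w - z)%C)).
    apply Rle_trans with
      (s * (INR (S n) * INR (S (S n)) * s ^ n * Cmod (w - z)%C ^ 2)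
       + INR (S (S n)) * s ^ S n * Cmod (w - z)%C ^ 2).
    + apply Rplus_le_compat.
      * apply Rmult_le_compat; trivial; apply Cmod_ge_0.
      * apply Rmult_le_compat_r; trivial. apply Rmult_le_compat_l; trivial.
    + rewrite <- (tech_pow_Rmult s n), (S_INR (S (S n))), (S_INR (S n)).
      assert (0 <= s * s ^ n * Cmod (w - z)%C ^ 2).
      { apply Rmult_le_pos; trivial. apply Rmult_le_pos; [lra | apply pow_le; lra]. }
      assert (Hm := pos_INR (S n)). nra.
Qed.

(** Termwise differentiation: the second order remainders of the monomials add up to that of [f],
    which is thus dominated by |w - z|^2 times the twice derived series of moduli at a radius [s]
    between |z| and 1. *)
Lemma is_derive_taylor (f : C -> C) (a : nat -> C) (z d : C) :
  taylor_coeffs f a -> in_disk z ->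
  is_series (K := C_AbsRing) (V := C_NormedModule)
    (fun n => (C_PS_derive a n * z ^ n)%C) d ->
  is_derive (K := C_AbsRing) (V := C_NormedModule) f z d.
Proof.
  intros Hf Hz Hd.
  set (s := (1 + Cmod z) / 2). unfold in_disk in Hz.
  assert (H0 := Cmod_ge_0 z).
  assert (Hs : Cmod z < s < 1) by (unfold s; lra).
  destruct (ex_series_disk (fun n => Cmod (C_PS_derive (C_PS_derive a) n)) s) as [B HB].
  { intros n; apply Cmod_ge_0. }
  { rewrite !CV_radius_C_PS_derive. now apply taylor_CV_radius with f. }
  { lra. }
  apply is_C_derive_quadratic with (s - Cmod z) B; [lra|].
  intros w Hwz.
  assert (Hw : Cmod w < s).
  { replace w with (z + (w - z))%C by ring.
    eapply Rle_lt_trans; [apply Cmod_triangle|]. lra. }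
  assert (Hfw := Hf w ltac:(unfold in_disk; lra)).
  assert (Hfz := Hf z ltac:(unfold in_disk; lra)).
  set (u := fun n => (a (S n) * (w ^ S n - z ^ S n - INR (S n) * z ^ n * (w - z)))%C).
  assert (Hu : is_series (K := C_AbsRing) (V := C_NormedModule) u (f w - f z - (w - z) * d)%C).
  { assert (H1 := is_series_minus (K := C_AbsRing) (V := C_NormedModule) _ _ _ _ Hfw Hfz).
    assert (H2 : is_series (K := C_AbsRing) (V := C_NormedModule)
      (fun n => (a (S n) * w ^ S n - a (S n) * z ^ S n)%C) (f w - f z)%C).
    { apply (is_series_incr_1 (K := C_AbsRing) (V := C_NormedModule)
               (fun n => (a n * w ^ n - a n * z ^ n)%C)).
      replace (plus (f w - f z)%C _) with (f w - f z)%C; [exact H1|].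
      change (f w - f z = (f w - f z) + (a O * 1 - a O * 1))%C. ring. }
    assert (H3 := is_series_scal (K := C_AbsRing) (V := C_NormedModule) (w - z)%C _ _ Hd).
    assert (H4 := is_series_minus (K := C_AbsRing) (V := C_NormedModule) _ _ _ _ H2 H3).
    eapply is_series_ext; [|exact H4].
    intros n. change (a (S n) * w ^ S n - a (S n) * z ^ S n - (w - z) * (C_PS_derive a n * z ^ n) = u n)%C.
    unfold u, C_PS_derive. ring. }
  (* The term [u 0] vanishes, since a linear monomial has no remainder; after the shift the
     exponents start at 2, as [pow_taylor2_bound] requires. *)
  assert (Hu' : is_series (K := C_AbsRing) (V := C_NormedModule) (fun n => u (S n)) (f w - f z - (w - z) * d)%C).
  { apply (is_series_incr_1 (K := C_AbsRing) (V := C_NormedModule) u).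
    replace (plus _ (u O)) with (f w - f z - (w - z) * d)%C; [exact Hu|].
    change (f w - f z - (w - z) * d = f w - f z - (w - z) * d + u O)%C.
    unfold u. simpl. ring. }
  apply (is_C_series_Cmod_le _ _ _ Hu').
  apply sum_n_Cmod_le with
    (fun n => Cmod (C_PS_derive (C_PS_derive a) n) * s ^ n * Cmod (w - z)%C ^ 2).
  - intros n. unfold u, C_PS_derive.
    rewrite Cmod_mult.
    eapply Rle_trans.
    { apply Rmult_le_compat_l; [apply Cmod_ge_0|].
      apply (pow_taylor2_bound w z s n); lra. }
    rewrite !Cmod_mult, !Cmod_R, !Rabs_pos_eq by apply pos_INR.
    apply Req_le. ring.
  - apply is_series_scal_r. exact HB.
Qed.

(** * Caratheodory's coefficient inequality *)

Lemma sum_n_Rplus (u v : nat -> R) (n : nat) :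
  sum_n (fun k => u k + v k) n = sum_n u n + sum_n v n.
Proof. exact (sum_n_plus (G := R_AbelianMonoid) u v n). Qed.

Lemma sum_n_Rmult_l (c : R) (u : nat -> R) (n : nat) :
  sum_n (fun k => c * u k) n = c * sum_n u n.
Proof. exact (sum_n_mult_l (K := R_Ring) c u n). Qed.

(** Telescoping: 2 sin(y/2) cos(ky) = sin((k + 1/2) y) - sin((k - 1/2) y). The sine sum below
    telescopes likewise into cosines. *)
Lemma sum_cos_mult (y : R) (n : nat) :
  2 * sin (y / 2) * sum_n (fun k => cos (INR k * y)) n
    = sin (INR (S n) * y - y / 2) + sin (y / 2).
Proof.
  induction n as [|n IH].
  - rewrite sum_O. simpl INR.
    replace (0 * y) with 0 by ring. replace (1 * y - y / 2) with (y / 2) by field.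
    rewrite cos_0. ring.
  - rewrite sum_Sn. unfold plus; simpl plus. rewrite Rmult_plus_distr_l, IH.
    rewrite (S_INR (S n)). set (c := INR (S n) * y).
    replace ((INR (S n) + 1) * y - y / 2) with (c + y / 2) by (unfold c; field).
    rewrite sin_plus, sin_minus. ring.
Qed.

Lemma sum_sin_mult (y : R) (n : nat) :
  2 * sin (y / 2) * sum_n (fun k => sin (INR k * y)) n
    = cos (y / 2) - cos (INR (S n) * y - y / 2).
Proof.
  induction n as [|n IH].
  - rewrite sum_O. simpl INR.
    replace (0 * y) with 0 by ring. replace (1 * y - y / 2) with (y / 2) by field.
    rewrite sin_0. ring.
  - rewrite sum_Sn. unfold plus; simpl plus. rewrite Rmult_plus_distr_l, IH.
    rewrite (S_INR (S n)). set (c := INR (S n) * y).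
    replace ((INR (S n) + 1) * y - y / 2) with (c + y / 2) by (unfold c; field).
    rewrite cos_plus, cos_minus. ring.
Qed.

(** Arguments of the roots of unity of order M + 1, the number of terms of [sum_n] up to [M]. *)
Definition root_angle (M k : nat) : R := INR k * (2 * PI / INR (S M)).

Lemma cos_sin_2PI_IZR (j : Z) : cos (IZR j * (2 * PI)) = 1 /\ sin (IZR j * (2 * PI)) = 0.
Proof.
  assert (H : forall n, cos (INR n * (2 * PI)) = 1 /\ sin (INR n * (2 * PI)) = 0).
  { intros n. replace (INR n * (2 * PI)) with (0 + 2 * INR n * PI) by ring.
    rewrite cos_period, sin_period, cos_0, sin_0. auto. }
  destruct (Z_le_dec 0 j) as [Hj|Hj].
  - rewrite <- (Z2Nat.id j Hj), <- INR_IZR_INZ. apply H.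
  - replace j with (- Z.of_nat (Z.to_nat (- j)))%Z by (rewrite Z2Nat.id; lia).
    rewrite opp_IZR, <- INR_IZR_INZ, Ropp_mult_distr_l_reverse, cos_neg, sin_neg.
    destruct (H (Z.to_nat (- j))) as [-> ->]. split; ring.
Qed.

(** The angle is pi j / (M + 1), whose absolute value lies strictly between 0 and pi. *)
Lemma sin_PI_frac_neq_0 (M : nat) (j : Z) :
  j <> 0%Z -> (Z.abs j <= Z.of_nat M)%Z ->
  sin (IZR j * (2 * PI / INR (S M)) / 2) <> 0.
Proof.
  assert (HN : 0 < INR (S M)) by (apply lt_0_INR; lia).
  assert (H : forall i : Z, (0 < i <= Z.of_nat M)%Z ->
              0 < sin (IZR i * (2 * PI / INR (S M)) / 2)).
  { intros i Hi. assert (Hp := PI_RGT_0).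
    assert (0 < IZR i) by (apply IZR_lt; lia).
    assert (IZR i < INR (S M)) by (rewrite INR_IZR_INZ; apply IZR_lt; lia).
    replace (IZR i * (2 * PI / INR (S M)) / 2) with (IZR i / INR (S M) * PI) by (field; lra).
    assert (0 < IZR i / INR (S M) < 1).
    { split; [now apply Rdiv_lt_0_compat|]. apply Rlt_div_l; lra. }
    apply sin_gt_0; nra. }
  intros Hj Hle.
  destruct (Z_lt_dec 0 j) as [H0|H0].
  - apply Rgt_not_eq, H. lia.
  - replace j with (- (- j))%Z by lia. rewrite opp_IZR.
    unfold Rdiv at 1. rewrite !Ropp_mult_distr_l_reverse, sin_neg.
    apply Ropp_neq_0_compat, Rgt_not_eq, H. lia.
Qed.

(** For j <> 0 the upper end of the telescoped sum sits at 2 pi j - y/2 and cancels the lower end;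
    the factor sin(y/2) is nonzero and can be divided out. *)
Lemma sum_cos_root_angle (M : nat) (j : Z) :
  (Z.abs j <= Z.of_nat M)%Z ->
  sum_n (fun k => cos (IZR j * root_angle M k)) M = if Z.eqb j 0 then INR (S M) else 0.
Proof.
  intros Hj. assert (HN : 0 < INR (S M)) by (apply lt_0_INR; lia).
  destruct (Z.eqb_spec j 0) as [->|H0].
  - rewrite (sum_n_ext _ (fun _ => 1)).
    + rewrite sum_n_const. apply Rmult_1_r.
    + intros k. rewrite Rmult_0_l. apply cos_0.
  - set (y := IZR j * (2 * PI / INR (S M))).
    rewrite (sum_n_ext _ (fun k => cos (INR k * y))).
    2: { intros k. unfold root_angle, y. f_equal. ring. }
    assert (Hs : sin (y / 2) <> 0) by (apply sin_PI_frac_neq_0; trivial).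
    assert (H := sum_cos_mult y M).
    replace (INR (S M) * y) with (IZR j * (2 * PI)) in H by (unfold y; field; lra).
    rewrite sin_minus in H. destruct (cos_sin_2PI_IZR j) as [E1 E2]. rewrite E1, E2 in H.
    apply (Rmult_eq_reg_l (2 * sin (y / 2))); lra.
Qed.

Lemma sum_sin_root_angle (M : nat) (j : Z) :
  (Z.abs j <= Z.of_nat M)%Z -> sum_n (fun k => sin (IZR j * root_angle M k)) M = 0.
Proof.
  intros Hj. assert (HN : 0 < INR (S M)) by (apply lt_0_INR; lia).
  destruct (Z.eq_dec j 0) as [->|H0].
  - rewrite (sum_n_ext _ (fun _ => 0)).
    + rewrite sum_n_const. apply Rmult_0_r.
    + intros k. rewrite Rmult_0_l. apply sin_0.
  - set (y := IZR j * (2 * PI / INR (S M))).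
    rewrite (sum_n_ext _ (fun k => sin (INR k * y))).
    2: { intros k. unfold root_angle, y. f_equal. ring. }
    assert (Hs : sin (y / 2) <> 0) by (apply sin_PI_frac_neq_0; trivial).
    assert (H := sum_sin_mult y M).
    replace (INR (S M) * y) with (IZR j * (2 * PI)) in H by (unfold y; field; lra).
    rewrite cos_minus in H. destruct (cos_sin_2PI_IZR j) as [E1 E2]. rewrite E1, E2 in H.
    apply (Rmult_eq_reg_l (2 * sin (y / 2))); lra.
Qed.

(* The Fourier coefficients of [(cos t + b)^2]. *)
Definition square_weight_coef (b : R) (n : nat) : R :=
  match n with 0%nat => 1 / 2 + b ^ 2 | 1%nat => b | 2%nat => 1 / 4 | _ => 0 end.

Lemma cos_mult_square_weight (b s t : R) :
  cos s * (cos t + b) ^ 2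
    = (1 / 2 + b ^ 2) * cos s + (b * (cos (s + t) + cos (s - t))
      + 1 / 4 * (cos (s + 2 * t) + cos (s - 2 * t))).
Proof.
  rewrite !cos_plus, !cos_minus, cos_2a_cos. field.
Qed.

Lemma sin_mult_square_weight (b s t : R) :
  sin s * (cos t + b) ^ 2
    = (1 / 2 + b ^ 2) * sin s + (b * (sin (s + t) + sin (s - t))
      + 1 / 4 * (sin (s + 2 * t) + sin (s - 2 * t))).
Proof.
  rewrite !sin_plus, !sin_minus, cos_2a_cos. field.
Qed.

(** The product has frequencies n, n - 1, n + 1, n - 2 and n + 2, none beyond [M] in absolute value.
    Only frequency 0 survives the summation, and it occurs for n <= 2 alone. *)
Lemma sum_cos_square_weight (M n : nat) (b : R) :
  (n + 2 <= M)%nat ->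
  sum_n (fun k => cos (INR n * root_angle M k) * (cos (root_angle M k) + b) ^ 2) M
    = INR (S M) * square_weight_coef b n.
Proof.
  intros Hn. set (j := Z.of_nat n).
  rewrite (sum_n_ext _ (fun k =>
    (1 / 2 + b ^ 2) * cos (IZR j * root_angle M k)
    + (b * (cos (IZR (j + 1) * root_angle M k) + cos (IZR (j - 1) * root_angle M k))
    + 1 / 4 * (cos (IZR (j + 2) * root_angle M k) + cos (IZR (j - 2) * root_angle M k))))).
  2: { intros k. rewrite cos_mult_square_weight. unfold j.
       rewrite !plus_IZR, !minus_IZR, <- INR_IZR_INZ.
       repeat (f_equal; try ring). }
  rewrite !sum_n_Rplus, !sum_n_Rmult_l, !sum_n_Rplus, !sum_cos_root_angle by lia.
  unfold j. destruct n as [|[|[|n]]]; simpl square_weight_coef.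
  1-3: simpl; lra.
  repeat match goal with |- context [Z.eqb ?a 0] =>
    replace (Z.eqb a 0) with false by (symmetry; apply Z.eqb_neq; lia) end.
  lra.
Qed.

Lemma sum_sin_square_weight (M n : nat) (b : R) :
  (n + 2 <= M)%nat ->
  sum_n (fun k => sin (INR n * root_angle M k) * (cos (root_angle M k) + b) ^ 2) M = 0.
Proof.
  intros Hn. set (j := Z.of_nat n).
  rewrite (sum_n_ext _ (fun k =>
    (1 / 2 + b ^ 2) * sin (IZR j * root_angle M k)
    + (b * (sin (IZR (j + 1) * root_angle M k) + sin (IZR (j - 1) * root_angle M k))
    + 1 / 4 * (sin (IZR (j + 2) * root_angle M k) + sin (IZR (j - 2) * root_angle M k))))).
  2: { intros k. rewrite sin_mult_square_weight. unfold j.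
       rewrite !plus_IZR, !minus_IZR, <- INR_IZR_INZ.
       repeat (f_equal; try ring). }
  rewrite !sum_n_Rplus, !sum_n_Rmult_l, !sum_n_Rplus, !sum_sin_root_angle by lia.
  lra.
Qed.

Definition cis (t : R) : C := (cos t, sin t).

Lemma Cmod_cis (t : R) : Cmod (cis t) = 1.
Proof.
  unfold Cmod, cis. simpl fst; simpl snd. rewrite <- !Rsqr_pow2, Rplus_comm, sin2_cos2.
  apply sqrt_1.
Qed.

Lemma cis_pow (t : R) (n : nat) : (cis t ^ n)%C = cis (INR n * t).
Proof.
  induction n as [|n IH].
  - simpl. unfold cis. rewrite Rmult_0_l, cos_0, sin_0. reflexivity.
  - rewrite Cpow_S, IH, S_INR. unfold cis, Cmult. simpl fst; simpl snd.
    replace ((INR n + 1) * t) with (t + INR n * t) by ring.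
    rewrite cos_plus, sin_plus. f_equal; ring.
Qed.

Lemma sum_monomial_square_weight (M n : nat) (q : C) (r b : R) :
  (n + 2 <= M)%nat ->
  sum_n (fun k => Re (q * (r * cis (root_angle M k)) ^ n)%C
                  * (cos (root_angle M k) + b) ^ 2) M
    = INR (S M) * (square_weight_coef b n * r ^ n * Re q).
Proof.
  intros Hn.
  rewrite (sum_n_ext _ (fun k =>
    r ^ n * Re q * (cos (INR n * root_angle M k) * (cos (root_angle M k) + b) ^ 2)
    + - (r ^ n * Im q) * (sin (INR n * root_angle M k) * (cos (root_angle M k) + b) ^ 2))).
  2: { intros k. rewrite Cpow_mult_l, cis_pow, <- RtoC_pow. unfold cis.
       destruct q as [x y]. simpl. ring. }
  rewrite sum_n_Rplus, !sum_n_Rmult_l, sum_cos_square_weight, sum_sin_square_weight by lia.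
  lra.
Qed.

(** Monomials of degree above 2 are orthogonal to the weight. The polynomial has degree m + 2 and
    the weight adds 2 more, whence m + 4 <= M. *)
Lemma sum_poly_square_weight (M m : nat) (q : nat -> C) (r b : R) :
  (m + 4 <= M)%nat ->
  sum_n (fun k => Re (sum_n (G := C_NormedModule)
                       (fun n => (q n * (r * cis (root_angle M k)) ^ n)%C) (S (S m)))
                  * (cos (root_angle M k) + b) ^ 2) M
    = INR (S M) * ((1 / 2 + b ^ 2) * Re (q 0%nat) + b * r * Re (q 1%nat)
                   + 1 / 4 * r ^ 2 * Re (q 2%nat)).
Proof.
  intros Hm. induction m as [|m IH].
  - rewrite (sum_n_ext _ (fun k =>
      Re (q 0%nat * (r * cis (root_angle M k)) ^ 0)%C * (cos (root_angle M k) + b) ^ 2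
      + (Re (q 1%nat * (r * cis (root_angle M k)) ^ 1)%C * (cos (root_angle M k) + b) ^ 2
      + Re (q 2%nat * (r * cis (root_angle M k)) ^ 2)%C * (cos (root_angle M k) + b) ^ 2))).
    + rewrite !sum_n_Rplus, !sum_monomial_square_weight by lia. simpl. lra.
    + intros k. rewrite !sum_Sn, sum_O.
      generalize (cos (root_angle M k) + b). intros w.
      generalize (q 0%nat * (r * cis (root_angle M k)) ^ 0)%C,
        (q 1%nat * (r * cis (root_angle M k)) ^ 1)%C,
        (q 2%nat * (r * cis (root_angle M k)) ^ 2)%C.
      intros [x0 y0] [x1 y1] [x2 y2]. simpl. change plus with Rplus. lra.
  - rewrite (sum_n_ext _ (fun k =>
      Re (sum_n (G := C_NormedModule)
            (fun n => (q n * (r * cis (root_angle M k)) ^ n)%C) (S (S m)))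
        * (cos (root_angle M k) + b) ^ 2
      + Re (q (S (S (S m))) * (r * cis (root_angle M k)) ^ S (S (S m)))%C
        * (cos (root_angle M k) + b) ^ 2)).
    + rewrite sum_n_Rplus, IH, sum_monomial_square_weight by lia. simpl. lra.
    + intros k. rewrite (sum_Sn _ (S (S m))).
      generalize (cos (root_angle M k) + b). intros w.
      generalize (q (S (S (S m))) * (r * cis (root_angle M k)) ^ S (S (S m)))%C,
        (sum_n (G := C_NormedModule)
           (fun n => (q n * (r * cis (root_angle M k)) ^ n)%C) (S (S m))).
      intros [x0 y0] [x1 y1]. simpl. change plus with Rplus. lra.
Qed.

(** All the tails on the circle |z| = r are dominated by the tail of one real series, so [N] does
    not depend on [z]. *)
Lemma series_tail_uniform (q : nat -> C) (p : C -> C) (r eps : R) :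
  0 <= r -> 0 < eps -> ex_series (fun n => Cmod (q n) * r ^ n) ->
  (forall z, Cmod z = r -> is_series (K := C_AbsRing) (V := C_NormedModule)
               (fun n => (q n * z ^ n)%C) (p z)) ->
  exists N, forall m z, (N <= m)%nat -> Cmod z = r ->
    Cmod (p z - sum_n (G := C_NormedModule) (fun n => (q n * z ^ n)%C) m)%C <= eps.
Proof.
  intros Hr He [B HB] Hp.
  destruct (proj1 (filterlim_locally_ball_norm
                     (K := R_AbsRing) (U := R_NormedModule) _ _) HB
              (mkposreal eps He)) as [N HN].
  exists N. intros m z Hm Hz.
  assert (Hi := is_series_incr_n (K := C_AbsRing) (V := C_NormedModule)
    (fun n => (q n * z ^ n)%C) (S m) (p z - sum_n (G := C_NormedModule) (fun n => (q n * z ^ n)%C) m)%C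
    ltac:(lia)).
  assert (Hj := is_series_incr_n (fun n => Cmod (q n) * r ^ n) (S m)
    (B - sum_n (fun n => Cmod (q n) * r ^ n) m) ltac:(lia)).
  simpl pred in Hi, Hj.
  apply Rle_trans with (B - sum_n (fun n => Cmod (q n) * r ^ n) m).
  - eapply is_C_series_Cmod_le; [apply Hi|].
    + replace (plus _ _) with (p z); [now apply Hp|].
      unfold plus; simpl. unfold sum_n. ring.
    + apply sum_n_Cmod_le with (fun k => Cmod (q (S m + k)%nat) * r ^ (S m + k)).
      * intros n. rewrite Cmod_mult, Cmod_pow, Hz. apply Rle_refl.
      * apply Hj. replace (plus _ _) with B; [exact HB|].
        assert (E : forall u s : R, u = (u - s) + s) by (intros; ring). apply E.
  - assert (H := HN m Hm).
    change (Rabs (sum_n (fun n => Cmod (q n) * r ^ n) m - B) < eps) in H.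
    apply Rabs_def2 in H. lra.
Qed.

(** The right-hand side is the mean of Re p (cos t + b)^2 over roots of unity, computed exactly once
    [p] is replaced by a Taylor polynomial. As [B] bounds the weight, a polynomial error of e / B
    costs at most [e]. *)
Lemma caratheodory_Re_radius (q : nat -> C) (p : C -> C) (r b : R) :
  0 <= r -> ex_series (fun n => Cmod (q n) * r ^ n) ->
  (forall z, Cmod z = r -> is_series (K := C_AbsRing) (V := C_NormedModule)
               (fun n => (q n * z ^ n)%C) (p z)) ->
  (forall z, Cmod z = r -> 0 <= Re (p z)) ->
  0 <= (1 / 2 + b ^ 2) * Re (q 0%nat) + b * r * Re (q 1%nat) + 1 / 4 * r ^ 2 * Re (q 2%nat).
Proof.
  intros Hr Hex Hp Hpos.
  set (A := (1 / 2 + b ^ 2) * Re (q 0%nat) + b * r * Re (q 1%nat) + 1 / 4 * r ^ 2 * Re (q 2%nat)).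
  set (B := (1 + Rabs b) ^ 2).
  assert (HB : 0 < B) by (unfold B; apply pow_lt; generalize (Rabs_pos b); lra).
  apply le_epsilon. intros e He.
  destruct (series_tail_uniform q p r (e / B) Hr) as [N HN]; trivial.
  { now apply Rdiv_lt_0_compat. }
  set (M := (N + 4)%nat).
  assert (HM : 0 < INR (S M)) by (apply lt_0_INR; lia).
  assert (Hs := sum_poly_square_weight M N q r b (Nat.le_refl _)).
  fold A in Hs.
  set (g := fun k => Re (sum_n (G := C_NormedModule)
                       (fun n => (q n * (r * cis (root_angle M k)) ^ n)%C) (S (S N)))
                  * (cos (root_angle M k) + b) ^ 2) in Hs.
  assert (Hg : forall k, - e <= g k).
  { intros k. unfold g. set (z := (r * cis (root_angle M k))%C).
    assert (Hz : Cmod z = r).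
    { unfold z. rewrite Cmod_mult, Cmod_cis, Cmod_R, Rabs_pos_eq; lra. }
    assert (H1 := HN (S (S N)) z ltac:(lia) Hz). assert (H2 := Hpos z Hz).
    set (s := sum_n (G := C_NormedModule) _ _) in *.
    assert (H3 : Re (p z) - Re s <= e / B).
    { change (Re (p z - s)%C <= e / B).
      eapply Rle_trans; [apply Rle_abs|].
      eapply Rle_trans; [apply re_le_Cmod | exact H1]. }
    assert (Hw : 0 <= (cos (root_angle M k) + b) ^ 2 <= B).
    { split; [apply pow2_ge_0|]. unfold B. rewrite <- !Rsqr_pow2. apply Rsqr_le_abs_1.
      rewrite (Rabs_pos_eq (1 + Rabs b)) by (generalize (Rabs_pos b); lra).
      eapply Rle_trans; [apply Rabs_triang|]. apply Rplus_le_compat_r.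
      apply Rabs_le. apply COS_bound. }
    set (w := (cos (root_angle M k) + b) ^ 2) in *.
    assert (H4 : e / B * B = e) by (field; lra).
    assert (0 < e / B) by now apply Rdiv_lt_0_compat.
    nra. }
  assert (Hsum : - e * INR (S M) <= sum_n g M).
  { clear Hs. clearbody M g. clear HM. induction M as [|M IH].
    - rewrite sum_O. simpl. specialize (Hg 0%nat). lra.
    - rewrite sum_Sn, S_INR. change plus with Rplus. specialize (Hg (S M)).
      simpl in *. lra. }
  rewrite Hs in Hsum. nra.
Qed.

Lemma caratheodory_Re (q : nat -> C) (p : C -> C) :
  q 0%nat = 1 -> Rbar_le 1 (CV_radius (fun n => Cmod (q n))) ->
  (forall z, in_disk z -> is_series (K := C_AbsRing) (V := C_NormedModule)
               (fun n => (q n * z ^ n)%C) (p z)) ->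
  (forall z, in_disk z -> 0 <= Re (p z)) ->
  Re (q 1%nat) ^ 2 - 2 <= Re (q 2%nat).
Proof.
  intros H0 Hc Hp Hpos.
  set (D := Re (q 1%nat) ^ 2 - Re (q 2%nat)).
  assert (H : forall r, 0 <= r < 1 -> r ^ 2 * D <= 2).
  { intros r Hr.
    (* This [b] minimizes the quadratic b^2 + b r Re q_1. *)
    assert (H := caratheodory_Re_radius q p r (- (r * Re (q 1%nat)) / 2) (proj1 Hr)).
    rewrite H0 in H. simpl Re in H.
    assert (H' : 0 <= (1 / 2 + (- (r * Re (q 1%nat)) / 2) ^ 2) * 1
        + - (r * Re (q 1%nat)) / 2 * r * Re (q 1%nat) + 1 / 4 * r ^ 2 * Re (q 2%nat)).
    { apply H.
      - apply (ex_series_disk (fun n => Cmod (q n))); trivial. intros n; apply Cmod_ge_0.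
      - intros z Hz. apply Hp. unfold in_disk. lra.
      - intros z Hz. apply Hpos. unfold in_disk. lra. }
    unfold D. nra. }
  apply Rnot_lt_le. intros HD. assert (HD' : 2 < D) by (unfold D; lra).
  assert (Hd : 0 < 2 / D < 1).
  { split; [apply Rdiv_lt_0_compat; lra|]. apply Rlt_div_l; lra. }
  (* With s = 2 / D < 1, the radius r = (s + 3) / 4 satisfies r^2 - s = (1 - s)(9 - s) / 16 > 0, so
     r^2 D > 2, a contradiction. *)
  specialize (H ((2 / D + 3) / 4) ltac:(lra)).
  assert (E : 2 / D * D = 2) by (field; lra).
  set (s := 2 / D) in *.
  assert (s < ((s + 3) / 4) ^ 2) by nra. nra.
Qed.

(** Restates at type [C] an equality typed in the carrier of a normed module, so that [field]
    applies. *)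
Ltac C_eq := match goal with |- ?a = ?b => change (@eq C a b) end.

(* For [k] off the negative axis and [m = |k|], [m + conj k] has half the argument
   of [conj k]. *)
Lemma exists_rotation_sqr (k : C) :
  exists e : C, Cmod e = 1 /\ (k * e ^ 2)%C = RtoC (Cmod k).
Proof.
  set (m := Cmod k).
  destruct (Ceq_dec (m + Cconj k)%C 0) as [E|E].
  (* Here k = - m is real and nonpositive, possibly 0, and i^2 = - 1 makes it positive or null. *)
  - exists Ci. split; [apply Cmod_Ci|].
    assert (Ek : k = (- m)%C).
    { rewrite <- (Cconj_conj k). replace (Cconj k) with (- m)%C.
      - unfold Cconj, Copp, RtoC; simpl. f_equal; ring.
      - replace (Cconj k) with ((m + Cconj k) - m)%C by ring. rewrite E. ring. }
    rewrite Ek. simpl. unfold Ci, Cmult, Copp, RtoC; simpl. f_equal; ring.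
  - assert (Hn : Cmod (m + Cconj k)%C <> 0).
    { intros H. now apply E, Cmod_eq_0. }
    exists ((m + Cconj k) / Cmod (m + Cconj k)%C)%C.
    assert (Hc : RtoC (Cmod (m + Cconj k)%C) <> 0).
    { intros H. apply Hn. now injection H. }
    split.
    + rewrite Cmod_div, Cmod_R, (Rabs_pos_eq _ (Cmod_ge_0 _)) by trivial.
      now apply Rinv_r.
    + assert (H1 : RtoC (Cmod (m + Cconj k)%C ^ 2) = ((m + Cconj k) * (m + k))%C).
      { rewrite Cmod2_conj. f_equal. rewrite Cplus_conj, Cconj_conj. f_equal.
        unfold Cconj, RtoC; simpl. f_equal; ring. }
      assert (H2 : RtoC (m ^ 2) = (k * Cconj k)%C) by (unfold m; now rewrite Cmod2_conj).
      rewrite RtoC_pow in H1, H2.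
      set (d := RtoC (Cmod (m + Cconj k)%C)) in *.
      (* From k conj k = m^2 follows k (m + conj k) = m (m + k). *)
      assert (H3 : (k * (m + Cconj k) ^ 2 = m * d ^ 2)%C).
      { rewrite H1.
        replace (k * (m + Cconj k) ^ 2)%C
          with ((m + Cconj k) * (k * m + k * Cconj k))%C by ring.
        rewrite <- H2. ring. }
      replace (k * ((m + Cconj k) / d) ^ 2)%C with (k * (m + Cconj k) ^ 2 / d ^ 2)%C
        by (field; exact Hc).
      rewrite H3. field. exact Hc.
Qed.

(* Caratheodory's inequality [|p_2 - p_1^2/2| <= 2 - |p_1|^2/2] for
   [p = f'], where [p_1 = 2 a_2] and [p_2 = 3 a_3]. *)
Lemma class_R_coef_bound (f : C -> C) (a : nat -> C) :
  class_R f -> taylor_coeffs f a ->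
  Cmod (3 * a 3%nat - 2 * a 2%nat ^ 2)%C <= 2 - 2 * Cmod (a 2%nat) ^ 2.
Proof.
  intros [[_ [_ Hf1]] Hpos] Ht.
  set (D := (3 * a 3%nat - 2 * a 2%nat ^ 2)%C).
  destruct (exists_rotation_sqr D) as [e [He HD]].
  (* The factor i gives D s^2 = - |D|, so that a lower bound on a real part becomes an upper bound
     on |D|. *)
  set (s := (Ci * e)%C).
  assert (Hs : Cmod s = 1) by (unfold s; rewrite Cmod_mult, Cmod_Ci, He; ring).
  assert (HDs : (D * s ^ 2)%C = (- Cmod D)%C).
  { unfold s. replace (D * (Ci * e) ^ 2)%C with (Ci * Ci * (D * e ^ 2))%C by ring.
    rewrite HD. unfold Ci, Cmult, Copp, RtoC; simpl. f_equal; ring. }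
  assert (Hc := taylor_CV_radius f a Ht). rewrite <- CV_radius_C_PS_derive in Hc.
  assert (Hder : forall z, in_disk z ->
    is_series (K := C_AbsRing) (V := C_NormedModule)
      (fun n => (C_PS_derive a n * z ^ n)%C) (C_derive f z) /\
    is_derive (K := C_AbsRing) (V := C_NormedModule) f z (C_derive f z)).
  { intros z Hz. destruct (ex_C_series_disk _ z Hc Hz) as [d Hd].
    assert (H := is_derive_taylor f a z d Ht Hz Hd).
    now rewrite (is_C_derive_unique _ _ _ H). }
  assert (Ha1 : a 1%nat = 1).
  { assert (Hd0 : is_derive (K := C_AbsRing) (V := C_NormedModule) f (RtoC 0) (a 1%nat)).
    { apply (is_derive_taylor f a); trivial.
      - unfold in_disk. rewrite Cmod_0. lra.
      - apply is_C_series_alt. intros eps. exists 0%nat. intros n _.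
        replace (sum_n (G := C_NormedModule) _ n) with (a 1%nat).
        + replace (a 1%nat - a 1%nat)%C with (RtoC 0) by ring.
          rewrite Cmod_0. apply cond_pos.
        + induction n as [|n IH].
          * rewrite sum_O. unfold C_PS_derive. simpl. ring.
          * rewrite sum_Sn, <- IH. change plus with Cplus. rewrite Cpow_S. ring. }
    rewrite <- (is_C_derive_unique _ _ _ Hd0). now apply is_C_derive_unique. }
  assert (Hrot : forall z, in_disk z -> in_disk (s * z)%C).
  { intros z Hz. unfold in_disk. rewrite Cmod_mult, Hs, Rmult_1_l. exact Hz. }
  assert (H := caratheodory_Re (fun n => (C_PS_derive a n * s ^ n)%C)
                 (fun z => C_derive f (s * z)%C)).
  assert (H' : Re (C_PS_derive a 1 * s ^ 1)%C ^ 2 - 2 <= Re (C_PS_derive a 2 * s ^ 2)%C).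
  { apply H; clear H.
    - unfold C_PS_derive. rewrite Ha1. simpl. ring.
    - rewrite (CV_radius_ext _ (fun n => Cmod (C_PS_derive a n))); trivial.
      intros n. rewrite Cmod_mult, Cmod_pow, Hs, pow1. ring.
    - intros z Hz. destruct (Hder _ (Hrot z Hz)) as [H _].
      eapply is_series_ext; [|exact H]. intros n.
      cbv beta. rewrite Cpow_mult_l. apply Cmult_assoc.
    - intros z Hz. destruct (Hder _ (Hrot z Hz)) as [_ H].
      apply Rlt_le, (Hpos (s * z)%C); auto. }
  replace (C_PS_derive a 1 * s ^ 1)%C with (2 * (a 2%nat * s))%C in H'
    by (unfold C_PS_derive; simpl INR; rewrite ?RtoC_plus; ring).
  replace (C_PS_derive a 2 * s ^ 2)%C with (D * s ^ 2 + 2 * (a 2%nat * s) ^ 2)%C in H'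
    by (unfold C_PS_derive, D; simpl INR; rewrite ?RtoC_plus; ring).
  rewrite HDs in H'.
  replace (Cmod (a 2%nat)) with (Cmod (a 2%nat * s)%C) by (rewrite Cmod_mult, Hs; ring).
  rewrite Cmod2_alt.
  (* With a_2 s = x + i y the inequality reads 4 x^2 - 2 <= - |D| + 2 (x^2 - y^2). *)
  set (m := Cmod D) in *. destruct (a 2%nat * s)%C as [x y]. simpl in *. nra.
Qed.

(** * Extremal functions *)

(** [f] is the termwise primitive of [p] vanishing at 0; the bound on [q] gives its series radius of
    convergence at least 1. *)
Lemma class_R_of_derivative_series (q : nat -> C) (p : C -> C) :
  q 0%nat = 1 -> (forall n, Cmod (q n) <= 2) ->
  (forall z, in_disk z -> is_series (K := C_AbsRing) (V := C_NormedModule)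
               (fun n => (q n * z ^ n)%C) (p z)) ->
  (forall z, in_disk z -> 0 < Re (p z)) ->
  exists f a, class_R f /\ taylor_coeffs f a /\
    (2 * a 2%nat)%C = q 1%nat /\ (3 * a 3%nat)%C = q 2%nat.
Proof.
  intros Hq0 Hq Hp Hpos.
  set (a := fun n => match n with 0%nat => RtoC 0 | S k => (q k / INR (S k))%C end).
  assert (Hnz : forall n, RtoC (INR (S n)) <> 0).
  { intros n H. exact (not_0_INR (S n) (Nat.neq_succ_0 n) (RtoC_inj _ _ H)). }
  assert (Haq : forall n, C_PS_derive a n = q n).
  { intros n. unfold C_PS_derive, a. field. apply Hnz. }
  assert (Hc : Rbar_le 1 (CV_radius (fun n => Cmod (a n)))).
  { rewrite <- CV_radius_C_PS_derive. apply CV_radius_ge_1.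
    intros r Hr. exists 2. intros n. rewrite Haq, Rabs_pos_eq.
    - assert (0 <= r ^ n <= 1).
      { split; [apply pow_le; lra|]. rewrite <- (pow1 n). apply pow_incr. lra. }
      specialize (Hq n). generalize (Cmod_ge_0 (q n)). nra.
    - apply Rmult_le_pos; [apply Cmod_ge_0 | apply pow_le; lra]. }
  (* [Series] is total, so [f] is defined on all of [C]; in the disk it is the complex sum. *)
  set (f := fun z : C => (Series (fun n => Re (a n * z ^ n)%C),
                          Series (fun n => Im (a n * z ^ n)%C)) : C).
  assert (Ht : taylor_coeffs f a).
  { intros z Hz. destruct (ex_C_series_disk a z Hc Hz) as [l Hl].
    replace (f z) with l; [exact Hl|].
    assert (Hl' := proj1 (is_C_series_alt _ _) Hl).
    assert (HS : forall n, sum_n (G := C_NormedModule) (fun n => (a n * z ^ n)%C) n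
       = (sum_n (fun n => Re (a n * z ^ n)%C) n, sum_n (fun n => Im (a n * z ^ n)%C) n)).
    { induction n as [|n IH].
      - rewrite !sum_O. apply surjective_pairing.
      - rewrite !sum_Sn, IH. reflexivity. }
    unfold f. rewrite (surjective_pairing l). f_equal; symmetry; apply is_series_unique.
    - apply filterlim_locally. intros eps. destruct (Hl' eps) as [N HN]. exists N.
      intros n Hn. eapply Rle_lt_trans; [|apply (HN n Hn)]. rewrite HS.
      match goal with |- _ <= Cmod ?w => exact (re_le_Cmod w) end.
    - apply filterlim_locally. intros eps. destruct (Hl' eps) as [N HN]. exists N.
      intros n Hn. eapply Rle_lt_trans; [|apply (HN n Hn)]. rewrite HS.
      match goal with |- _ <= Cmod ?w =>
        exact (Rle_trans _ _ _ (Rmax_r _ _) (Rmax_Cmod w)) end. }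
  assert (Hd : forall z, in_disk z ->
    is_derive (K := C_AbsRing) (V := C_NormedModule) f z (p z)).
  { intros z Hz. apply (is_derive_taylor f a); trivial.
    eapply is_series_ext; [|apply (Hp z Hz)]. intros n. simpl. now rewrite Haq. }
  assert (H0 : in_disk 0) by (unfold in_disk; rewrite Cmod_0; lra).
  assert (Hsum0 : forall (b : nat -> C) l, is_series (K := C_AbsRing) (V := C_NormedModule)
            (fun n => (b n * RtoC 0 ^ n)%C) l -> l = b 0%nat).
  { intros b l Hl. apply (filterlim_locally_unique (K := C_AbsRing) (V := C_NormedModule)
      (sum_n (G := C_NormedModule) (fun n => (b n * RtoC 0 ^ n)%C)) l (b 0%nat) Hl).
    eapply filterlim_ext; [|apply filterlim_const].
    intros n. simpl. induction n as [|n IH].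
    - rewrite sum_O. simpl. ring.
    - rewrite sum_Sn, <- IH. change plus with Cplus. rewrite Cpow_S. ring. }
  exists f, a. split; [split; [split; [|split]|]|split; [exact Ht|split]].
  - intros z Hz. exists (p z). auto.
  - rewrite (Hsum0 a (f 0) (Ht 0 H0)). reflexivity.
  - rewrite <- Hq0, <- (Hsum0 q (p 0) (Hp 0 H0)). auto.
  - intros z Hz l Hl. rewrite <- (is_C_derive_unique _ _ _ Hl).
    rewrite (is_C_derive_unique _ _ _ (Hd z Hz)). auto.
  - rewrite <- Haq. unfold C_PS_derive. simpl INR. rewrite ?RtoC_plus. ring.
  - rewrite <- Haq. unfold C_PS_derive. simpl INR. rewrite ?RtoC_plus. ring.
Qed.

(** Taylor coefficients of [herglotz_kernel u] at 0. *)
Definition herglotz_coef (u : C) (n : nat) : C :=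
  match n with 0%nat => 1 | _ => (2 * u ^ n)%C end.

Definition herglotz_kernel (u z : C) : C := ((1 + u * z) / (1 - u * z))%C.

(** With X = u z the partial sums are geometric and differ from the kernel by 2 X^(n+1) / (1 - X),
    up to sign. *)
Lemma is_series_herglotz (u z : C) :
  Cmod u = 1 -> in_disk z ->
  is_series (K := C_AbsRing) (V := C_NormedModule)
    (fun n => (herglotz_coef u n * z ^ n)%C) (herglotz_kernel u z).
Proof.
  intros Hu Hz. set (X := (u * z)%C).
  assert (HX : Cmod X < 1) by (unfold X; rewrite Cmod_mult, Hu, Rmult_1_l; exact Hz).
  assert (H1 : (1 - X)%C <> 0).
  { intros H. replace X with (1 - (1 - X))%C in HX by ring. rewrite H in HX.
    replace (1 - 0)%C with (RtoC 1) in HX by ring. rewrite Cmod_1 in HX. lra. }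
  assert (HS : forall n, sum_n (G := C_NormedModule) (fun n => (herglotz_coef u n * z ^ n)%C) n
     = ((1 + X - 2 * X ^ S n) / (1 - X))%C).
  { induction n as [|n IH].
    - rewrite sum_O. C_eq. simpl. field. exact H1.
    - rewrite sum_Sn, IH. change plus with Cplus.
      replace (herglotz_coef u (S n) * z ^ S n)%C with (2 * X ^ S n)%C.
      + C_eq. rewrite (Cpow_S X (S n)). field. exact H1.
      + unfold X. rewrite Cpow_mult_l. simpl. ring. }
  apply is_C_series_alt. intros eps.
  assert (Hp : 0 < Cmod (1 - X)%C) by now apply Cmod_gt_0.
  assert (He : 0 < eps * Cmod (1 - X)%C / 2).
  { generalize (cond_pos eps). intros. nra. }
  destruct (pow_lt_1_zero (Cmod X)) with (2 := He) as [N HN].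
  { rewrite Rabs_pos_eq; [exact HX | apply Cmod_ge_0]. }
  exists N. intros n Hn. rewrite HS. unfold herglotz_kernel. fold X.
  replace ((1 + X - 2 * X ^ S n) / (1 - X) - (1 + X) / (1 - X))%C
    with (- (2 * X ^ S n / (1 - X)))%C by (field; exact H1).
  rewrite Cmod_opp, Cmod_div, Cmod_mult, Cmod_pow, Cmod_R, (Rabs_pos_eq 2) by (trivial; lra).
  specialize (HN (S n) ltac:(lia)).
  rewrite Rabs_pos_eq in HN by apply pow_le, Cmod_ge_0.
  apply Rlt_div_l; lra.
Qed.

(** Re ((1 + X) / (1 - X)) = (1 - |X|^2) / |1 - X|^2. *)
Lemma herglotz_kernel_Re_pos (u z : C) :
  Cmod u = 1 -> in_disk z -> 0 < Re (herglotz_kernel u z).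
Proof.
  intros Hu Hz. unfold herglotz_kernel. set (X := (u * z)%C).
  assert (HX : Cmod X < 1) by (unfold X; rewrite Cmod_mult, Hu, Rmult_1_l; exact Hz).
  assert (H2 : Cmod X ^ 2 < 1) by (generalize (Cmod_ge_0 X); nra).
  rewrite Cmod2_alt in H2. destruct X as [x y]. simpl in H2.
  assert (Hd : 0 < (1 - x) ^ 2 + y ^ 2) by nra.
  replace (Re ((1 + (x, y)) / (1 - (x, y)))%C)
    with ((1 - x ^ 2 - y ^ 2) / ((1 - x) ^ 2 + y ^ 2)).
  - apply Rdiv_lt_0_compat; nra.
  - simpl. field. nra.
Qed.

(* The extremal derivative is the Herglotz transform of a two-point measure at
   [alpha +- i sqrt (1 - alpha^2)] with mean [c], where [alpha = Re c]. *)
Lemma class_R_extremal (c : C) :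
  Cmod c <= 1 ->
  exists f a, class_R f /\ taylor_coeffs f a /\ a 2%nat = c /\
    (3 * a 3%nat)%C = (2 * (c ^ 2 - (1 - Cmod c ^ 2)%R))%C.
Proof.
  intros Hc.
  assert (H2 : Re c ^ 2 + Im c ^ 2 <= 1).
  { rewrite <- Cmod2_alt. generalize (Cmod_ge_0 c). nra. }
  rewrite Cmod2_alt. destruct c as [x y]. simpl Re in *. simpl Im in *. clear Hc.
  set (s := sqrt (1 - x ^ 2)).
  assert (Hs : s ^ 2 = 1 - x ^ 2) by (apply pow2_sqrt; nra).
  assert (Hs0 : 0 <= s) by apply sqrt_pos.
  (* The weights (1 + t) / 2 and (1 - t) / 2 put the mean at x + i t s. If s = 0 then y = 0;
     otherwise t = y / s works because y^2 <= s^2. *)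
  assert (Ht : exists t, -1 <= t <= 1 /\ t * s = y).
  { destruct (Req_dec s 0) as [E|E].
    - exists 0. split; [lra|]. rewrite E in Hs |- *. nra.
    - exists (y / s). split; [|field; trivial].
      assert (E' : y / s * s = y) by (field; trivial).
      set (t := y / s) in *.
      assert (t ^ 2 <= 1); [|nra].
      apply (Rmult_le_reg_r (s ^ 2)); [nra|].
      replace (t ^ 2 * s ^ 2) with (y ^ 2) by (rewrite <- E'; ring). lra. }
  destruct Ht as [t [Ht1 Ht2]].
  set (u := (x, s) : C). set (v := (x, - s) : C).
  assert (Hu : Cmod u = 1).
  { unfold Cmod, u; simpl fst; simpl snd. apply (eq_trans (y := sqrt 1)); [f_equal|apply sqrt_1]. lra. }
  assert (Hv : Cmod v = 1).
  { unfold Cmod, v; simpl fst; simpl snd. apply (eq_trans (y := sqrt 1)); [f_equal|apply sqrt_1]. nra. }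
  assert (Hh : forall u n, Cmod u = 1 -> Cmod (herglotz_coef u n) <= 2).
  { intros u' n Hu'. destruct n as [|n]; unfold herglotz_coef.
    - rewrite Cmod_1. lra.
    - rewrite Cmod_mult, Cmod_pow, Hu', pow1, Cmod_R, Rabs_pos_eq; lra. }
  destruct (class_R_of_derivative_series
    (fun n => (RtoC ((1 + t) / 2) * herglotz_coef u n
               + RtoC ((1 - t) / 2) * herglotz_coef v n)%C)
    (fun z => (RtoC ((1 + t) / 2) * herglotz_kernel u z
               + RtoC ((1 - t) / 2) * herglotz_kernel v z)%C))
    as [f [a [Hf [Hta [E2 E3]]]]].
  - simpl. rewrite !Cmult_1_r, <- RtoC_plus. f_equal. field.
  - intros n. eapply Rle_trans; [apply Cmod_triangle|].
    rewrite !Cmod_mult, !Cmod_R, !Rabs_pos_eq by lra.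
    generalize (Hh u n Hu), (Hh v n Hv). nra.
  - intros z Hz.
    assert (H1 := is_series_scal (K := C_AbsRing) (V := C_NormedModule)
                    (RtoC ((1 + t) / 2)) _ _ (is_series_herglotz u z Hu Hz)).
    assert (H3 := is_series_scal (K := C_AbsRing) (V := C_NormedModule)
                    (RtoC ((1 - t) / 2)) _ _ (is_series_herglotz v z Hv Hz)).
    eapply is_series_ext;
      [|exact (is_series_plus (K := C_AbsRing) (V := C_NormedModule) _ _ _ _ H1 H3)].
    intros n. change plus with Cplus. change scal with Cmult. simpl. ring.
  - intros z Hz. generalize (herglotz_kernel_Re_pos u z Hu Hz), (herglotz_kernel_Re_pos v z Hv Hz).
    destruct (herglotz_kernel u z) as [a1 b1], (herglotz_kernel v z) as [a2 b2].
    simpl. nra.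
  - exists f, a. split; [exact Hf|]. split; [exact Hta|]. split.
    + replace (a 2%nat) with (2 * a 2%nat * / 2)%C by (field; intros H; injection H; lra).
      rewrite E2. unfold u, v. simpl. unfold Cmult, Cplus, RtoC, Cinv; simpl.
      f_equal; [field|]. rewrite <- Ht2. field.
    (* The mean of the squares of the two points is 2 x^2 - 1 + 2 i x y, that is c^2 - (1 -
       |c|^2). *)
    + rewrite E3. unfold u, v. simpl. unfold Cmult, Cplus, Cminus, Copp, RtoC; simpl.
      f_equal; [nra|]. rewrite <- Ht2. field.
Qed.

(** * Reduction to a quadratic in |a_2| and its optimization *)

Lemma Cmod_functional_bounds (lam : C) (f : C -> C) (a : nat -> C) :
  class_R f -> taylor_coeffs f a ->
  let x := Cmod (2 - 3 * lam)%C in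
  let t := Cmod (a 2%nat) in
  let m := Cmod (a 3%nat - lam * a 2%nat * a 2%nat)%C in
  0 <= t <= 1 /\ 3 * m <= x * t ^ 2 + (2 - 2 * t ^ 2) /\
  x * t ^ 2 - (2 - 2 * t ^ 2) <= 3 * m.
Proof.
  intros Hf Ht x t m.
  assert (HD := class_R_coef_bound f a Hf Ht). fold t in HD.
  set (D := (3 * a 3%nat - 2 * a 2%nat ^ 2)%C) in HD.
  assert (H0 := Cmod_ge_0 D).
  assert (Ht0 : 0 <= t) by apply Cmod_ge_0.
  assert (Hm : 3 * m = Cmod (3 * (a 3%nat - lam * a 2%nat * a 2%nat))%C).
  { rewrite Cmod_mult, Cmod_R, Rabs_pos_eq; [reflexivity | lra]. }
  assert (HE : Cmod ((2 - 3 * lam) * a 2%nat ^ 2)%C = x * t ^ 2).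
  { now rewrite Cmod_mult, Cmod_pow. }
  (* t <= 1 because 0 <= |D| <= 2 - 2 t^2. *)
  split; [nra|]. split.
  - rewrite Hm, <- HE.
    replace (3 * (a 3%nat - lam * a 2%nat * a 2%nat))%C
      with ((2 - 3 * lam) * a 2%nat ^ 2 + D)%C by (unfold D; ring).
    eapply Rle_trans; [apply Cmod_triangle|]. lra.
  - rewrite Hm, <- HE.
    replace ((2 - 3 * lam) * a 2%nat ^ 2)%C
      with (3 * (a 3%nat - lam * a 2%nat * a 2%nat) + - D)%C by (unfold D; ring).
    assert (H := Cmod_triangle (3 * (a 3%nat - lam * a 2%nat * a 2%nat)) (- D)).
    rewrite Cmod_opp in H. lra.
Qed.

(** For the extremal function with a_2 = c and |c| = t, 3 (a_3 - lam a_2^2) = (2 - 3 lam) c^2 - (2 -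
    2 t^2). Choosing the argument of [c] so that the first term is - x t^2 or x t^2 makes the two
    terms add up or oppose each other. *)
Lemma Ffun_attained (lam : C) (mu t : R) :
  0 <= t <= 1 ->
  let x := Cmod (2 - 3 * lam)%C in
  (exists f a, class_R f /\ taylor_coeffs f a /\
     Ffun lam mu a = (x * t ^ 2 + (2 - 2 * t ^ 2)) / 3 - mu * t) /\
  (exists f a, class_R f /\ taylor_coeffs f a /\
     Ffun lam mu a = Rabs (x * t ^ 2 - (2 - 2 * t ^ 2)) / 3 - mu * t).
Proof.
  intros Ht x.
  assert (H3 : forall c, Cmod c = t -> exists f a, class_R f /\ taylor_coeffs f a /\
     Ffun lam mu a = Cmod ((2 - 3 * lam) * c ^ 2 - (2 - 2 * t ^ 2)%R)%C / 3 - mu * t).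
  { intros c Hc. destruct (class_R_extremal c) as [f [a [Hf [Ha [E2 E3]]]]]; [lra|].
    exists f, a. split; [exact Hf|]. split; [exact Ha|].
    unfold Ffun. rewrite E2, Hc. f_equal.
    apply (Rmult_eq_reg_l 3); [|lra].
    replace (3 * (Cmod ((2 - 3 * lam) * c ^ 2 - (2 - 2 * t ^ 2)%R)%C / 3))
      with (Cmod ((2 - 3 * lam) * c ^ 2 - (2 - 2 * t ^ 2)%R)%C) by field.
    rewrite <- (Rabs_pos_eq 3) at 1 by lra. rewrite <- Cmod_R, <- Cmod_mult. f_equal.
    replace (3 * (a 3%nat - lam * c * c))%C with (3 * a 3%nat - 3 * lam * c ^ 2)%C by ring.
    rewrite E3, Hc, !RtoC_minus, !RtoC_mult. ring. }
  destruct (exists_rotation_sqr (2 - 3 * lam)%C) as [e [He Hk]]. fold x in Hk.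
  assert (Hx : 0 <= x) by apply Cmod_ge_0.
  split.
  - destruct (H3 (t * (Ci * e))%C) as [f [a [Hf [Ha E]]]].
    + rewrite !Cmod_mult, Cmod_Ci, He, Cmod_R, Rabs_pos_eq; lra.
    + exists f, a. split; [exact Hf|]. split; [exact Ha|]. rewrite E.
      replace ((2 - 3 * lam) * (t * (Ci * e)) ^ 2)%C
        with (Ci * Ci * t ^ 2 * ((2 - 3 * lam) * e ^ 2))%C by ring.
      rewrite Hk.
      replace (Ci * Ci * t ^ 2 * x - (2 - 2 * t ^ 2)%R)%C
        with (RtoC (- (x * t ^ 2 + (2 - 2 * t ^ 2)))).
      * rewrite Cmod_R, Rabs_Ropp, Rabs_pos_eq; [reflexivity | nra].
      * rewrite <- RtoC_pow. unfold Ci, Cmult, Cminus, Cplus, Copp, RtoC; simpl. f_equal; ring.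
  - destruct (H3 (t * e)%C) as [f [a [Hf [Ha E]]]].
    + rewrite !Cmod_mult, He, Cmod_R, Rabs_pos_eq; lra.
    + exists f, a. split; [exact Hf|]. split; [exact Ha|]. rewrite E.
      replace ((2 - 3 * lam) * (t * e) ^ 2)%C
        with (t ^ 2 * ((2 - 3 * lam) * e ^ 2))%C by ring.
      rewrite Hk, <- RtoC_pow, <- RtoC_mult, <- RtoC_minus, Cmod_R.
      now rewrite (Rmult_comm x).
Qed.

Theorem theorem4p1 (lam : C) (mu : R) (hmu : 0 <= mu) :
  let x := Cmod (2 - 3 * lam)%C in
  (* upper bound, first case *)
  (x >= 2 + 3 * mu ->
     (forall f a, class_R f -> taylor_coeffs f a ->
        Ffun lam mu a <= (x - 3 * mu) / 3) /\
     (exists f a, class_R f /\ taylor_coeffs f a /\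
        Ffun lam mu a = (x - 3 * mu) / 3)) /\
  (* upper bound, second case *)
  (x < 2 + 3 * mu ->
     (forall f a, class_R f -> taylor_coeffs f a ->
        Ffun lam mu a <= 2 / 3) /\
     (exists f a, class_R f /\ taylor_coeffs f a /\
        Ffun lam mu a = 2 / 3)) /\
  (* lower bound, first case *)
  (x <= (3 * mu - 4) / 2 ->
     (forall f a, class_R f -> taylor_coeffs f a ->
        - ((3 * mu - x) / 3) <= Ffun lam mu a) /\
     (exists f a, class_R f /\ taylor_coeffs f a /\
        Ffun lam mu a = - ((3 * mu - x) / 3))) /\
  (* lower bound, second case *)
  (x >= (9 * mu ^ 2 - 16) / 8 ->
     (forall f a, class_R f -> taylor_coeffs f a ->
        - (mu * sqrt (2 / (x + 2))) <= Ffun lam mu a) /\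
     (exists f a, class_R f /\ taylor_coeffs f a /\
        Ffun lam mu a = - (mu * sqrt (2 / (x + 2))))) /\
  (* lower bound, third case *)
  ((3 * mu - 4) / 2 < x < (9 * mu ^ 2 - 16) / 8 ->
     (forall f a, class_R f -> taylor_coeffs f a ->
        - ((8 + 9 * mu ^ 2 / (x + 2)) / 12) <= Ffun lam mu a) /\
     (exists f a, class_R f /\ taylor_coeffs f a /\
        Ffun lam mu a = - ((8 + 9 * mu ^ 2 / (x + 2)) / 12))).
Proof.
  intros x.
  assert (Hx : 0 <= x) by apply Cmod_ge_0.
  assert (Hb : forall f a, class_R f -> taylor_coeffs f a ->
    exists t m, (0 <= t <= 1 /\ 0 <= m /\ 3 * m <= x * t ^ 2 + (2 - 2 * t ^ 2) /\
      x * t ^ 2 - (2 - 2 * t ^ 2) <= 3 * m) /\ Ffun lam mu a = m - mu * t).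
  { intros f a Hf Ha. destruct (Cmod_functional_bounds lam f a Hf Ha) as [H1 [H2 H3]].
    eexists _, _. split; [|reflexivity]. repeat split; try apply Cmod_ge_0; try apply H1; assumption. }
  assert (Hatt := fun t Ht => Ffun_attained lam mu t Ht). cbv zeta in Hatt. fold x in Hatt.
  split; [|split; [|split; [|split]]].
  - intros Hc. split.
    + intros f a Hf Ha. destruct (Hb f a Hf Ha) as [t [m [H ->]]].
      (* Three times the gap to be shown nonnegative is (1 - t)((x - 2)(1 + t) - 3 mu), the sum of
         these two products; it closes at t = 1. *)
      assert (0 <= (1 - t) * (x - 2 - 3 * mu)) by (apply Rmult_le_pos; lra).
      assert (0 <= t * (1 - t) * (x - 2)) by (repeat apply Rmult_le_pos; lra).
      nra.
    + destruct (Hatt 1 ltac:(lra)) as [[f [a [Hf [Ha E]]]] _].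
      exists f, a. split; [exact Hf|]. split; [exact Ha|]. rewrite E. field.
  - intros Hc. split.
    + intros f a Hf Ha. destruct (Hb f a Hf Ha) as [t [m [H ->]]].
      (* (x - 2) t^2 <= 3 mu t^2 <= 3 mu t, so the maximum is at t = 0. *)
      assert (0 <= t * (1 - t)) by (apply Rmult_le_pos; lra).
      assert (t ^ 2 * (x - 2) <= t ^ 2 * (3 * mu)) by (apply Rmult_le_compat_l; nra).
      assert (0 <= mu * (t * (1 - t))) by (apply Rmult_le_pos; lra).
      nra.
    + destruct (Hatt 0 ltac:(lra)) as [[f [a [Hf [Ha E]]]] _].
      exists f, a. split; [exact Hf|]. split; [exact Ha|]. rewrite E. field.
  - intros Hc. split.
    + intros f a Hf Ha. destruct (Hb f a Hf Ha) as [t [m [H ->]]].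
      (* This product is three times the gap, and (x + 2)(1 + t) <= 2 (x + 2) <= 3 mu; the minimum
         is at t = 1. *)
      assert (0 <= (1 - t) * (3 * mu - (x + 2) * (1 + t))).
      { apply Rmult_le_pos; nra. }
      nra.
    + destruct (Hatt 1 ltac:(lra)) as [_ [f [a [Hf [Ha E]]]]].
      exists f, a. split; [exact Hf|]. split; [exact Ha|]. rewrite E.
      rewrite Rabs_pos_eq by lra. field.
  (* At [t0] the lower bound ((x + 2) t^2 - 2) / 3 for [m] vanishes; up to [t0], m >= 0 suffices. *)
  - intros Hc. set (t0 := sqrt (2 / (x + 2))).
    assert (Ht0 : 0 <= t0) by apply sqrt_pos.
    assert (Ht2 : (x + 2) * t0 ^ 2 = 2).
    { unfold t0. rewrite pow2_sqrt; [field; lra|]. apply Rlt_le, Rdiv_lt_0_compat; lra. }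
    split.
    + intros f a Hf Ha. destruct (Hb f a Hf Ha) as [t [m [H ->]]].
      destruct (Rle_dec t t0) as [Hle|Hgt]; [nra|].
      (* beyond [t0], where the lower bound for [m] becomes positive, the
         quadratic is increasing because its vertex [3 mu / (2 (x + 2))] is at
         most [t0] *)
      assert (Hv : 3 * mu <= 2 * (x + 2) * t0).
      { apply Rsqr_incr_0_var; unfold Rsqr; nra. }
      assert (0 <= (t - t0) * ((x + 2) * (t + t0) - 3 * mu)).
      { apply Rmult_le_pos; nra. }
      nra.
    + assert (t0 <= 1) by nra.
      destruct (Hatt t0 ltac:(lra)) as [_ [f [a [Hf [Ha E]]]]].
      exists f, a. split; [exact Hf|]. split; [exact Ha|]. rewrite E.
      replace (x * t0 ^ 2 - (2 - 2 * t0 ^ 2)) with 0 by lra.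
      rewrite Rabs_R0. field.
  (* [t0] is the vertex of (x + 2) t^2 - 2 - 3 mu t. *)
  - intros Hc. set (t0 := 3 * mu / (2 * (x + 2))).
    assert (Ht : 2 * (x + 2) * t0 = 3 * mu) by (unfold t0; field; lra).
    assert (Ev : 9 * mu ^ 2 / (x + 2) = 4 * (x + 2) * t0 ^ 2) by (unfold t0; field; lra).
    rewrite Ev. split.
    + intros f a Hf Ha. destruct (Hb f a Hf Ha) as [t [m [H ->]]].
      assert (0 <= (x + 2) * (t - t0) ^ 2) by (apply Rmult_le_pos; [lra | apply pow2_ge_0]).
      nra.
    + assert (0 <= t0) by (apply Rdiv_le_0_compat; lra).
      (* The left inequality of the case says 3 mu < 2 (x + 2). *)
      assert (t0 <= 1) by nra.
      destruct (Hatt t0 ltac:(lra)) as [_ [f [a [Hf [Ha E]]]]].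
      exists f, a. split; [exact Hf|]. split; [exact Ha|]. rewrite E.
      (* The right inequality of the case, 8 (x + 2) < 9 mu^2, makes the quantity inside the
         absolute value nonnegative at the vertex. *)
      assert (2 <= (x + 2) * t0 ^ 2).
      { assert (8 * (x + 2) <= (2 * (x + 2) * t0) ^ 2) by (rewrite Ht; nra).
        apply (Rmult_le_reg_l (4 * (x + 2))); [lra|]. nra. }
      rewrite Rabs_pos_eq by lra. nra.
Qed.
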